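(* Let $R$ be a nonzero commutative ring with identity, let $G$ be a finite simple graph with vertex set $X=\{x_1,x_2,\dots,x_n\}$, and let $C_G(x_n)=\{v\in M(X;G) : [v,x_n]=0\}$ be the centralizer of $x_n$ in the partially commutative metabelian Lie algebra $M(X;G)$ over $R$. 1. If $x_n$ is an isolated vertex of $G$, then $C_G(x_n)$ consists of the elements $v=\alpha_n x_n$ with $\alpha_n\in R$. 2. If the degree of $x_n$ in $G$ is equal to $1$ and $x_n$ is adjacent to $x_{n-1}$, then $C_G(x_n)$ consists of all elements $v=\alpha_{n-1}x_{n-1}+\alpha_n x_n$ with $\alpha_{n-1},\alpha_n\in R$. 3. If the set of vertices adjacent to $x_n$ is exactly $\{x_{r+1},\dots,x_{n-1}\}$, where $r\leqslant n-3$, then $C_G(x_n)$ consists of all elements $v$ of the form $$v=\sum_{k=r+1}^n \alpha_k x_k+\sum_{r+1\leqslant i<j\leqslant n-1}[x_i,x_j].f_{ij},$$ where $\alpha_k\in R$ and $f_{ij}\in R[X\setminus\{x_n\}]$.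
   Context: $M(X;G)$ is the quotient of the free metabelian Lie $R$-algebra on $X$ (metabelian: $[[a,b],[c,d]]=0$ identically) by the ideal generated by all $[x_k,x_l]$ with $\{x_k,x_l\}$ an edge of $G$. Its derived subalgebra $M'(X;G)$ is a module over the commutative polynomial ring $R[X]$, where $u.x=[u,x]$ for $u\in M'(X;G)$, $x\in X$, extended by $u.(fg)=(u.f).g$ and linearity in $f$. *)

(* Defs.v *)
From HB Require Import structures.
From mathcomp Require Import all_boot all_algebra.
From mathcomp Require Import boolp.
From mathcomp Require Import ssrcomplements.
From mathcomp Require Export mpoly.

Set Implicit Arguments.
Unset Strict Implicit.
Unset Printing Implicit Defensive.

Import GRing.Theory.
Local Open Scope ring_scope.
Local Open Scope quotient_scope.

HB.mixin Record Lmodule_isLieAlgebra (R : comNzRingType) L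
    of GRing.Lmodule R L := {
  bracket : L -> L -> L;
  bracketPl : forall (a : R) (u v w : L),
    bracket (a *: u + v) w = a *: bracket u w + bracket v w;
  bracketPr : forall (a : R) (u v w : L),
    bracket w (a *: u + v) = a *: bracket w u + bracket w v;
  bracketxx : forall u : L, bracket u u = 0;
  jacobi : forall u v w : L,
    bracket (bracket u v) w + bracket (bracket v w) u
      + bracket (bracket w u) v = 0
}.

#[short(type="lieAlgType")]
HB.structure Definition LieAlgebra (R : comNzRingType) :=
  { L of Lmodule_isLieAlgebra R L & GRing.Lmodule R L }.

Notation "[ 'lie' u , v ]" := (bracket u v)
  (at level 0, u, v at level 99, format "[ 'lie'  u ,  v ]") : ring_scope.

Definition metabelian (R : comNzRingType) (L : lieAlgType R) : Prop :=
  forall a b c d : L, [lie [lie a, b], [lie c, d]] = 0.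

Definition centralizer (R : comNzRingType) (L : lieAlgType R) (a : L)
  : L -> Prop := fun v => [lie v, a] = 0.

Definition lie_morphism (R : comNzRingType) (L L' : lieAlgType R)
    (f : L -> L') : Prop :=
  (forall (a : R) u v, f (a *: u + v) = a *: f u + f v) /\
  (forall u v, f [lie u, v] = [lie f u, f v]).

Definition is_submodule (R : comNzRingType) (V : lmodType R) (P : V -> Prop)
  : Prop := P 0 /\ forall (a : R) u v, P u -> P v -> P (a *: u + v).

(* The derived subalgebra L': the submodule spanned by all brackets. *)
Definition derived (R : comNzRingType) (L : lieAlgType R) : L -> Prop :=
  fun v => forall P : L -> Prop,
    is_submodule P -> (forall a b, P [lie a, b]) -> P v.

(* Ideals are two-sided: closure on one side suffices by antisymmetry. *)
Definition is_ideal (R : comNzRingType) (L : lieAlgType R) (I : L -> Prop)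
  : Prop := is_submodule I /\ forall u v, I u -> I [lie u, v].

Definition ideal_gen (R : comNzRingType) (L : lieAlgType R) (S : L -> Prop)
  : L -> Prop :=
  fun v => forall I : L -> Prop, is_ideal I -> (forall s, S s -> I s) -> I v.

Section LieTheory.
Context {R : comNzRingType} {L : lieAlgType R}.
Implicit Types (u v w : L) (a : R).

Lemma bracketDl u v w : [lie u + v, w] = [lie u, w] + [lie v, w].
Proof. by rewrite -[u]scale1r bracketPl !scale1r. Qed.

Lemma bracketDr u v w : [lie w, u + v] = [lie w, u] + [lie w, v].
Proof. by rewrite -[u]scale1r bracketPr !scale1r. Qed.

Lemma bracket0l w : [lie 0, w] = 0.
Proof. by apply: (@addrI _ [lie 0, w]); rewrite -bracketDl !addr0. Qed.

Lemma bracket0r w : [lie w, 0] = 0.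
Proof. by apply: (@addrI _ [lie w, 0]); rewrite -bracketDr !addr0. Qed.

Lemma bracketZl a u w : [lie a *: u, w] = a *: [lie u, w].
Proof. by rewrite -[a *: u]addr0 bracketPl bracket0l addr0. Qed.

Lemma bracketZr a u w : [lie w, a *: u] = a *: [lie w, u].
Proof. by rewrite -[a *: u]addr0 bracketPr bracket0r addr0. Qed.

Lemma bracketNl u w : [lie - u, w] = - [lie u, w].
Proof. by rewrite -scaleN1r bracketZl scaleN1r. Qed.

Lemma bracketNr u w : [lie w, - u] = - [lie w, u].
Proof. by rewrite -scaleN1r bracketZr scaleN1r. Qed.

Lemma bracketC u v : [lie u, v] = - [lie v, u].
Proof.
apply/eqP; rewrite -addr_eq0; apply/eqP.
by rewrite -(bracketxx (u + v)) bracketDl !bracketDr !bracketxx add0r addr0.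
Qed.

Lemma derived_submodule : is_submodule (@derived R L).
Proof.
split=> [P [] //|a u v Hu Hv P HP HB].
by apply: (proj2 HP); [apply: Hu | apply: Hv].
Qed.

Lemma derived_bracket u v : derived [lie u, v].
Proof. by move=> P _ HB; apply: HB. Qed.

Lemma ideal_gen_ideal (S : L -> Prop) : is_ideal (ideal_gen S).
Proof.
split=> [|u v Hu I HI HS]; last by apply: (proj2 HI); apply: Hu.
split=> [I [] [] //|a u v Hu Hv I HI HS].
by apply: (proj2 (proj1 HI)); [apply: Hu | apply: Hv].
Qed.

Lemma ideal_gen_sub (S : L -> Prop) s : S s -> ideal_gen S s.
Proof. by move=> Ss I _; apply. Qed.

End LieTheory.

Section FreeMetabelian.
Variables (R : comNzRingType) (X : Type).

Inductive lie_term : Type :=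
| TGen of X
| TZero
| TAdd of lie_term & lie_term
| TOpp of lie_term
| TScale of R & lie_term
| TBracket of lie_term & lie_term.

(* The least congruence making the terms a metabelian Lie R-algebra. *)
Inductive lie_eq : lie_term -> lie_term -> Prop :=
| LRefl t : lie_eq t t
| LSym t u : lie_eq t u -> lie_eq u t
| LTrans t u v : lie_eq t u -> lie_eq u v -> lie_eq t v
| LAdd t t' u u' : lie_eq t t' -> lie_eq u u' -> lie_eq (TAdd t u) (TAdd t' u')
| LOpp t t' : lie_eq t t' -> lie_eq (TOpp t) (TOpp t')
| LScale a t t' : lie_eq t t' -> lie_eq (TScale a t) (TScale a t')
| LBracket t t' u u' :
    lie_eq t t' -> lie_eq u u' -> lie_eq (TBracket t u) (TBracket t' u')
| LAddA t u v : lie_eq (TAdd t (TAdd u v)) (TAdd (TAdd t u) v)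
| LAddC t u : lie_eq (TAdd t u) (TAdd u t)
| LAdd0 t : lie_eq (TAdd TZero t) t
| LAddN t : lie_eq (TAdd (TOpp t) t) TZero
| LScaleA a b t : lie_eq (TScale a (TScale b t)) (TScale (a * b) t)
| LScale1 t : lie_eq (TScale 1 t) t
| LScaleDr a t u :
    lie_eq (TScale a (TAdd t u)) (TAdd (TScale a t) (TScale a u))
| LScaleDl a b t :
    lie_eq (TScale (a + b) t) (TAdd (TScale a t) (TScale b t))
| LBracketPl a t u v :
    lie_eq (TBracket (TAdd (TScale a t) u) v)
           (TAdd (TScale a (TBracket t v)) (TBracket u v))
| LBracketPr a t u v :
    lie_eq (TBracket v (TAdd (TScale a t) u))
           (TAdd (TScale a (TBracket v t)) (TBracket v u))
| LBracketxx t : lie_eq (TBracket t t) TZero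
| LJacobi t u v :
    lie_eq (TAdd (TAdd (TBracket (TBracket t u) v) (TBracket (TBracket u v) t))
                 (TBracket (TBracket v t) u)) TZero
| LMetabelian t u v w :
    lie_eq (TBracket (TBracket t u) (TBracket v w)) TZero.

HB.instance Definition _ := gen_eqMixin lie_term.
HB.instance Definition _ := gen_choiceMixin lie_term.

Definition lie_eqb (t u : lie_term) : bool := `[< lie_eq t u >].

Lemma lie_eqb_equiv : equiv_class_of lie_eqb.
Proof.
split=> [t|t u|u t v].
- exact/asboolP/LRefl.
- by apply/asboolP/asboolP; apply: LSym.
- by move=> /asboolP tu /asboolP uv; apply/asboolP; apply: LTrans tu uv.
Qed.

Canonical lie_eqb_equivRel := EquivRelPack lie_eqb_equiv.
Canonical lie_eqb_encModRel := defaultEncModRel lie_eqb.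

Definition free_metabelian := {eq_quot lie_eqb}.
Local Notation F := free_metabelian.

HB.instance Definition _ := Choice.on F.

Local Notation cls t := (\pi_{eq_quot lie_eqb} t : F).

Lemma cls_eq t u : lie_eq t u <-> cls t = cls u.
Proof.
split=> [tu|/eqmodP/asboolP //].
by apply/eqmodP/asboolP.
Qed.

Lemma cls_repr (x : F) : cls (repr x) = x.
Proof. exact: reprK. Qed.

Lemma repr_cls t : lie_eq (repr (cls t)) t.
Proof. by apply/cls_eq; rewrite cls_repr. Qed.

Definition fm_zero : F := cls TZero.
(* The operations are locked so that unification does not unfold them. *)
Definition fm_add : F -> F -> F :=
  locked (fun x y => cls (TAdd (repr x) (repr y))).
Definition fm_opp : F -> F := locked (fun x => cls (TOpp (repr x))).
Definition fm_scale : R -> F -> F :=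
  locked (fun a x => cls (TScale a (repr x))).
Definition fm_bracket : F -> F -> F :=
  locked (fun x y => cls (TBracket (repr x) (repr y))).

Lemma cls_add t u : fm_add (cls t) (cls u) = cls (TAdd t u).
Proof.
rewrite /fm_add -lock; by apply/cls_eq; apply: LAdd; apply: repr_cls.
Qed.
Lemma cls_opp t : fm_opp (cls t) = cls (TOpp t).
Proof.
rewrite /fm_opp -lock; by apply/cls_eq; apply: LOpp; apply: repr_cls.
Qed.
Lemma cls_scale a t : fm_scale a (cls t) = cls (TScale a t).
Proof.
rewrite /fm_scale -lock; by apply/cls_eq; apply: LScale; apply: repr_cls.
Qed.
Lemma cls_bracket t u : fm_bracket (cls t) (cls u) = cls (TBracket t u).
Proof.
rewrite /fm_bracket -lock; by apply/cls_eq; apply: LBracket; apply: repr_cls.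
Qed.

Let clsE := (cls_add, cls_opp, cls_scale, cls_bracket).

Lemma fm_addA : associative fm_add.
Proof.
move=> x y z; rewrite -[x]cls_repr -[y]cls_repr -[z]cls_repr !clsE.
exact/cls_eq/LAddA.
Qed.
Lemma fm_addC : commutative fm_add.
Proof.
move=> x y; rewrite -[x]cls_repr -[y]cls_repr !clsE; exact/cls_eq/LAddC.
Qed.
Lemma fm_add0 : left_id fm_zero fm_add.
Proof. move=> x; rewrite -[x]cls_repr !clsE; exact/cls_eq/LAdd0. Qed.
Lemma fm_addN : left_inverse fm_zero fm_opp fm_add.
Proof. move=> x; rewrite -[x]cls_repr !clsE; exact/cls_eq/LAddN. Qed.

HB.instance Definition _ :=
  GRing.isZmodule.Build F fm_addA fm_addC fm_add0 fm_addN.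

Lemma fm_scaleA a b x : fm_scale a (fm_scale b x) = fm_scale (a * b) x.
Proof. rewrite -[x]cls_repr !clsE; exact/cls_eq/LScaleA. Qed.
Lemma fm_scale1 : left_id 1 fm_scale.
Proof. move=> x; rewrite -[x]cls_repr !clsE; exact/cls_eq/LScale1. Qed.
Lemma fm_scaleDr : right_distributive fm_scale (@GRing.add F).
Proof.
move=> a x y; rewrite -[x]cls_repr -[y]cls_repr /GRing.add /= !clsE.
exact/cls_eq/LScaleDr.
Qed.
Lemma fm_scaleDl x : {morph fm_scale^~ x : a b / a + b}.
Proof.
move=> a b; rewrite -[x]cls_repr.
rewrite -[RHS]/(fm_add (fm_scale a _) (fm_scale b _)) !clsE.
exact/cls_eq/LScaleDl.
Qed.

HB.instance Definition _ :=
  GRing.Zmodule_isLmodule.Build R F fm_scaleA fm_scale1 fm_scaleDr fm_scaleDl.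

Lemma cls_addE t u : cls t + cls u = cls (TAdd t u).
Proof. exact: cls_add. Qed.
Lemma cls_oppE t : - cls t = cls (TOpp t).
Proof. exact: cls_opp. Qed.
Lemma cls_scaleE a t : a *: cls t = cls (TScale a t).
Proof. exact: cls_scale. Qed.

Let clsE' := (cls_bracket, cls_addE, cls_oppE, cls_scaleE).

Lemma fm_bracketPl (a : R) (x y z : F) :
  fm_bracket (a *: x + y) z = a *: fm_bracket x z + fm_bracket y z.
Proof.
rewrite -[x]cls_repr -[y]cls_repr -[z]cls_repr !clsE'.
exact/cls_eq/LBracketPl.
Qed.
Lemma fm_bracketPr (a : R) (x y z : F) :
  fm_bracket z (a *: x + y) = a *: fm_bracket z x + fm_bracket z y.
Proof.
rewrite -[x]cls_repr -[y]cls_repr -[z]cls_repr !clsE'.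
exact/cls_eq/LBracketPr.
Qed.
Lemma fm_bracketxx (x : F) : fm_bracket x x = 0.
Proof. rewrite -[x]cls_repr !clsE'; exact/cls_eq/LBracketxx. Qed.
Lemma fm_jacobi (x y z : F) :
  fm_bracket (fm_bracket x y) z + fm_bracket (fm_bracket y z) x
    + fm_bracket (fm_bracket z x) y = 0.
Proof.
rewrite -[x]cls_repr -[y]cls_repr -[z]cls_repr !clsE'.
exact/cls_eq/LJacobi.
Qed.

HB.instance Definition _ := Lmodule_isLieAlgebra.Build R F
  fm_bracketPl fm_bracketPr fm_bracketxx fm_jacobi.

Definition fm_gen (x : X) : F := cls (TGen x).

Lemma cls_bracketE t u : [lie cls t, cls u] = cls (TBracket t u).
Proof. exact: cls_bracket. Qed.

Lemma free_metabelianP : metabelian F.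
Proof.
move=> a b c d.
rewrite -[a]cls_repr -[b]cls_repr -[c]cls_repr -[d]cls_repr !cls_bracketE.
exact/cls_eq/LMetabelian.
Qed.

Section Universal.
Variables (L : lieAlgType R) (Lmet : metabelian L) (f : X -> L).

Fixpoint lie_eval (t : lie_term) : L :=
  match t with
  | TGen x => f x
  | TZero => 0
  | TAdd t u => lie_eval t + lie_eval u
  | TOpp t => - lie_eval t
  | TScale a t => a *: lie_eval t
  | TBracket t u => [lie lie_eval t, lie_eval u]
  end.

Lemma lie_eval_eq t u : lie_eq t u -> lie_eval t = lie_eval u.
Proof.
elim=> //= *; try by congruence.
- exact: addrA.
- exact: addrC.
- exact: add0r.
- exact: addNr.
- exact: scalerA.
- exact: scale1r.
- exact: scalerDr.
- exact: scalerDl.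
- exact: bracketPl.
- exact: bracketPr.
- exact: bracketxx.
- exact: jacobi.
Qed.

Lemma free_metabelian_universal : exists g : F -> L,
  [/\ lie_morphism g, forall x, g (fm_gen x) = f x &
      forall g' : F -> L, lie_morphism g' ->
        (forall x, g' (fm_gen x) = f x) -> g' =1 g].
Proof.
pose g (x : F) := lie_eval (repr x).
have gE t : g (cls t) = lie_eval t by apply: lie_eval_eq; apply: repr_cls.
exists g; split=> [|x|g' [g'P g'B] g'X y]; last 1 first.
- have g'D u v : g' (u + v) = g' u + g' v.
    by rewrite -[u]scale1r g'P !scale1r.
  have g'0 : g' 0 = 0 by apply: (@addrI _ (g' 0)); rewrite -g'D !addr0.
  have g'Z a u : g' (a *: u) = a *: g' u.
    by rewrite -[a *: u]addr0 g'P g'0 addr0.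
  rewrite -[y]cls_repr gE; elim: (repr y) => //= [t IHt u IHu|t IHt|a t IHt|].
  + by rewrite -IHt -IHu -g'D -cls_addE.
  + by rewrite -IHt -scaleN1r -g'Z scaleN1r -cls_oppE.
  + by rewrite -IHt -g'Z -cls_scaleE.
  + by move=> t IHt u IHu; rewrite -IHt -IHu -g'B -cls_bracketE.
- split=> [a u v|u v]; rewrite -[u]cls_repr -[v]cls_repr.
    by rewrite cls_scaleE cls_addE !gE.
  by rewrite cls_bracketE !gE.
- exact: gE.
Qed.

End Universal.
End FreeMetabelian.

Section LieQuotient.
Variables (R : comNzRingType) (L : lieAlgType R) (S : L -> Prop).

Definition ideal_eqb (u v : L) : bool := `[< ideal_gen S (u - v) >].

Local Notation I := (ideal_gen S).
Let IP : is_ideal I := ideal_gen_ideal S.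
Let I0 : I 0. Proof. by case: IP => [[]]. Qed.
Let IZD (a : R) u v : I u -> I v -> I (a *: u + v).
Proof. by case: IP => [[_ H] _]; apply: H. Qed.
Let ID u v : I u -> I v -> I (u + v).
Proof. by move=> Iu Iv; rewrite -[u]scale1r; apply: IZD. Qed.
Let IZ (a : R) u : I u -> I (a *: u).
Proof. by move=> Iu; rewrite -[_ *: _]addr0; apply: IZD. Qed.
Let IN u : I u -> I (- u).
Proof. by move=> Iu; rewrite -scaleN1r; apply: IZ. Qed.
Let IB u v : I u -> I [lie u, v].
Proof. by case: IP => _; apply. Qed.

Lemma ideal_eqb_equiv : equiv_class_of ideal_eqb.
Proof.
split=> [u|u v|v u w].
- by apply/asboolP; rewrite subrr.
- by apply/asboolP/asboolP=> /IN; rewrite opprB.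
- move=> /asboolP uv /asboolP vw; apply/asboolP.
  by rewrite -[u](subrK v) -addrA; apply: ID.
Qed.

Canonical ideal_eqb_equivRel := EquivRelPack ideal_eqb_equiv.
Canonical ideal_eqb_encModRel := defaultEncModRel ideal_eqb.

Definition lie_quot := {eq_quot ideal_eqb}.
Local Notation Q := lie_quot.

HB.instance Definition _ := Choice.on Q.

Definition lie_proj (u : L) : Q := \pi_{eq_quot ideal_eqb} u.
Local Notation cls := lie_proj.

Lemma lie_proj_eq u v : cls u = cls v <-> I (u - v).
Proof. by split=> [/eqmodP/asboolP //|H]; apply/eqmodP/asboolP. Qed.

Lemma lie_projK (x : Q) : cls (repr x) = x.
Proof. exact: reprK. Qed.

Let repr_cls u : I (repr (cls u) - u).
Proof. by apply/lie_proj_eq; rewrite lie_projK. Qed.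

Definition lq_zero : Q := cls 0.
Definition lq_add : Q -> Q -> Q := locked (fun x y => cls (repr x + repr y)).
Definition lq_opp : Q -> Q := locked (fun x => cls (- repr x)).
Definition lq_scale : R -> Q -> Q := locked (fun a x => cls (a *: repr x)).
Definition lq_bracket : Q -> Q -> Q :=
  locked (fun x y => cls [lie repr x, repr y]).

Let cls_add u v : lq_add (cls u) (cls v) = cls (u + v).
Proof.
rewrite /lq_add -lock; apply/lie_proj_eq; rewrite opprD addrACA.
exact: ID.
Qed.
Let cls_opp u : lq_opp (cls u) = cls (- u).
Proof.
rewrite /lq_opp -lock; apply/lie_proj_eq; rewrite -opprD.
exact: IN.
Qed.
Let cls_scale a u : lq_scale a (cls u) = cls (a *: u).
Proof.
rewrite /lq_scale -lock; apply/lie_proj_eq; rewrite -scalerBr.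
exact: IZ.
Qed.
Let cls_bracket u v : lq_bracket (cls u) (cls v) = cls [lie u, v].
Proof.
rewrite /lq_bracket -lock; apply/lie_proj_eq; set u' := repr _; set v' := repr _.
have -> : [lie u', v'] - [lie u, v] = [lie u' - u, v'] - [lie v' - v, u].
  rewrite [[lie v' - v, u]]bracketC opprK.
  by rewrite bracketDl bracketDr bracketNl bracketNr addrA subrK.
by apply: ID; [|apply: IN]; apply: IB; apply: repr_cls.
Qed.

Let clsE := (cls_add, cls_opp, cls_scale, cls_bracket).

Lemma lq_addA : associative lq_add.
Proof.
move=> x y z; rewrite -[x]lie_projK -[y]lie_projK -[z]lie_projK !clsE.
by rewrite addrA.
Qed.
Lemma lq_addC : commutative lq_add.
Proof. by move=> x y; rewrite -[x]lie_projK -[y]lie_projK !clsE addrC. Qed.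
Lemma lq_add0 : left_id lq_zero lq_add.
Proof. by move=> x; rewrite -[x]lie_projK !clsE add0r. Qed.
Lemma lq_addN : left_inverse lq_zero lq_opp lq_add.
Proof. by move=> x; rewrite -[x]lie_projK !clsE addNr. Qed.

HB.instance Definition _ :=
  GRing.isZmodule.Build Q lq_addA lq_addC lq_add0 lq_addN.

Lemma lq_scaleA a b x : lq_scale a (lq_scale b x) = lq_scale (a * b) x.
Proof. by rewrite -[x]lie_projK !clsE scalerA. Qed.
Lemma lq_scale1 : left_id 1 lq_scale.
Proof. by move=> x; rewrite -[x]lie_projK !clsE scale1r. Qed.
Lemma lq_scaleDr : right_distributive lq_scale (@GRing.add Q).
Proof.
move=> a x y; rewrite -[x]lie_projK -[y]lie_projK /GRing.add /= !clsE.
by rewrite scalerDr.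
Qed.
Lemma lq_scaleDl x : {morph lq_scale^~ x : a b / a + b}.
Proof.
move=> a b; rewrite -[x]lie_projK.
by rewrite -[RHS]/(lq_add (lq_scale a _) (lq_scale b _)) !clsE scalerDl.
Qed.

HB.instance Definition _ :=
  GRing.Zmodule_isLmodule.Build R Q lq_scaleA lq_scale1 lq_scaleDr lq_scaleDl.

Lemma lq_addE u v : cls u + cls v = cls (u + v).
Proof. exact: cls_add. Qed.
Lemma lq_scaleE a u : a *: cls u = cls (a *: u).
Proof. exact: cls_scale. Qed.

Let clsE' := (cls_bracket, lq_addE, lq_scaleE).

Lemma lq_bracketPl (a : R) (x y z : Q) :
  lq_bracket (a *: x + y) z = a *: lq_bracket x z + lq_bracket y z.
Proof.
rewrite -[x]lie_projK -[y]lie_projK -[z]lie_projK.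
by rewrite !clsE' bracketPl.
Qed.
Lemma lq_bracketPr (a : R) (x y z : Q) :
  lq_bracket z (a *: x + y) = a *: lq_bracket z x + lq_bracket z y.
Proof.
rewrite -[x]lie_projK -[y]lie_projK -[z]lie_projK.
by rewrite !clsE' bracketPr.
Qed.
Lemma lq_bracketxx (x : Q) : lq_bracket x x = 0.
Proof. by rewrite -[x]lie_projK !clsE' bracketxx. Qed.
Lemma lq_jacobi (x y z : Q) :
  lq_bracket (lq_bracket x y) z + lq_bracket (lq_bracket y z) x
    + lq_bracket (lq_bracket z x) y = 0.
Proof.
by rewrite -[x]lie_projK -[y]lie_projK -[z]lie_projK !clsE' jacobi.
Qed.

HB.instance Definition _ := Lmodule_isLieAlgebra.Build R Q
  lq_bracketPl lq_bracketPr lq_bracketxx lq_jacobi.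

Lemma lie_proj_morphism : lie_morphism lie_proj.
Proof.
split=> [a u v|u v]; first by rewrite lq_scaleE lq_addE.
by rewrite -cls_bracket.
Qed.

Lemma lie_proj_eq0 u : lie_proj u = 0 <-> ideal_gen S u.
Proof. by rewrite -[X in ideal_gen S X]subr0; apply: lie_proj_eq. Qed.

End LieQuotient.

Section PartiallyCommutative.
Variables (R : comNzRingType) (n : nat) (G : rel 'I_n).

Definition edge_relators (w : free_metabelian R 'I_n) : Prop :=
  exists k l, G k l /\ w = [lie fm_gen R k, fm_gen R l].

Definition pcm := lie_quot edge_relators.

HB.instance Definition _ := LieAlgebra.on pcm.

Definition pcm_gen (i : 'I_n) : pcm := lie_proj edge_relators (fm_gen R i).

Lemma pcm_metabelian : metabelian pcm.
Proof.
have [_ H] := lie_proj_morphism edge_relators.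
move=> a b c d; rewrite -[a]lie_projK -[b]lie_projK -[c]lie_projK -[d]lie_projK.
rewrite -!H free_metabelianP; apply/lie_proj_eq0.
by have [[]] := ideal_gen_ideal edge_relators.
Qed.

Lemma pcm_edge k l : G k l -> [lie pcm_gen k, pcm_gen l] = 0.
Proof.
move=> Gkl; have [_ <-] := lie_proj_morphism edge_relators.
by apply/lie_proj_eq0; apply: ideal_gen_sub; exists k; exists l.
Qed.

(* [pcm_act u f] is u.f.  The operators u |-> [u, x_i] commute only on the
   derived subalgebra, so the formula is meaningful for [derived u] only; the
   order of the variables chosen below is then irrelevant. *)
Definition pcm_act_mon (u : pcm) (m : 'X_{1..n}) : pcm :=
  foldl (fun v i => iter (m i) (fun w => [lie w, pcm_gen i]) v) u (enum 'I_n).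

Definition pcm_act (u : pcm) (f : {mpoly R[n]}) : pcm :=
  \sum_(m <- msupp f) f@_m *: pcm_act_mon u m.

(* The following lemmas say that [pcm_act] makes the derived subalgebra an
   R[X]-module in which x_i acts as [u |-> [u, x_i]]. *)

Local Notation act := pcm_act.
Local Notation D i := (fun w : pcm => [lie w, pcm_gen i]).
Local Notation acts s m u :=
  (foldl (fun (v : pcm) i => iter (m i) (D i) v) (u : pcm) s).

Let bracket_comm (u : pcm) i j :
  derived u -> [lie [lie u, pcm_gen i], pcm_gen j]
               = [lie [lie u, pcm_gen j], pcm_gen i].
Proof.
move=> Du.
have H : [lie [lie pcm_gen i, pcm_gen j], u] = 0.
  apply: (Du (fun v => [lie [lie pcm_gen i, pcm_gen j], v] = 0)).
    split=> [|a v w Hv Hw]; first exact: bracket0r.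
    by rewrite bracketPr Hv Hw scaler0 addr0.
  by move=> a b; apply: pcm_metabelian.
move: (jacobi u (pcm_gen i) (pcm_gen j)).
rewrite H addr0 [[lie pcm_gen j, u]]bracketC bracketNl.
by move/eqP; rewrite subr_eq0 => /eqP.
Qed.

Let derived_iter i k u : derived u -> derived (iter k (D i) u).
Proof. by case: k => [|k] //= _; apply: derived_bracket. Qed.

Let derived_acts s (m : 'X_{1..n}) u : derived u -> derived (acts s m u).
Proof. by elim: s u => //= i s IHs u Du; apply: IHs; apply: derived_iter. Qed.

Let iter_comm1 i j k u :
  derived u -> D i (iter k (D j) u) = iter k (D j) (D i u).
Proof.
move=> Du; elim: k => //= k <-; rewrite bracket_comm //; exact: derived_iter.
Qed.

Let iter_comm i j k l u : derived u ->
  iter l (D i) (iter k (D j) u) = iter k (D j) (iter l (D i) u).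
Proof.
move=> Du; elim: l => //= l ->; rewrite iter_comm1 //; exact: derived_iter.
Qed.

Let acts_iter s (m : 'X_{1..n}) i k u : derived u ->
  acts s m (iter k (D i) u) = iter k (D i) (acts s m u).
Proof.
elim: s u => //= j s IHs u Du.
by rewrite iter_comm // IHs //; apply: derived_iter.
Qed.

Let actsD s (m1 m2 : 'X_{1..n}) u : derived u ->
  acts s (m1 + m2)%MM u = acts s m2 (acts s m1 u).
Proof.
elim: s u => //= i s IHs u Du.
rewrite mnmDE addnC iterD IHs; last by do 2!apply: derived_iter.
by congr foldl; rewrite acts_iter //; apply: derived_iter.
Qed.

Lemma pcm_act_monD u m1 m2 : derived u ->
  pcm_act_mon u (m1 + m2)%MM = pcm_act_mon (pcm_act_mon u m1) m2.
Proof. exact: actsD. Qed.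

Lemma pcm_act_mon0 u : pcm_act_mon u 0%MM = u.
Proof. by rewrite /pcm_act_mon; elim: (enum _) => //= i s; rewrite mnm0E. Qed.

Lemma pcm_act_mon1 u i : pcm_act_mon u U_(i)%MM = [lie u, pcm_gen i].
Proof.
rewrite /pcm_act_mon.
have H s : uniq s -> acts s U_(i)%MM u = if i \in s then D i u else u.
  elim: s u => //= j s IHs v /andP[js us].
  rewrite mnm1E in_cons; case: eqVneq => [ij|ij] /=; last exact: IHs.
  rewrite -{}ij in js *; elim: s js {IHs us} => //= k s IHs; rewrite in_cons negb_or.
  by case/andP=> ik ks; rewrite mnm1E (negPf ik) /=; apply: IHs.
by rewrite H ?enum_uniq // mem_enum.
Qed.

Lemma pcm_act_mon_linear a u v m :
  pcm_act_mon (a *: u + v) m = a *: pcm_act_mon u m + pcm_act_mon v m.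
Proof.
rewrite /pcm_act_mon; elim: (enum _) u v => //= i s IHs u v; rewrite -IHs.
by congr foldl; elim: (m i) => //= k ->; rewrite bracketPl.
Qed.

Lemma pcm_actwE u f k : (msize f <= k)%N ->
  act u f = \sum_(m : 'X_{1..n < k}) f@_m *: pcm_act_mon u m.
Proof.
move=> le_fk; set I : subFinType _ := 'X_{1..n < k}.
rewrite /pcm_act (big_mksub I) ?msupp_uniq //=; first last.
  by move=> x /msize_mdeg_lt /leq_trans; apply.
by rewrite big_rmcond //= => j /memN_msupp_eq0 ->; rewrite scale0r.
Qed.

Lemma pcm_act_linear_r u a f g : act u (a *: f + g) = a *: act u f + act u g.
Proof.
pose k := maxn (msize (a *: f + g)) (maxn (msize f) (msize g)).
rewrite !(@pcm_actwE u _ k) ?leq_max ?leqnn ?orbT //.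
rewrite scaler_sumr -big_split /=; apply: eq_bigr => m _.
by rewrite mcoeffD mcoeffZ scalerDl scalerA.
Qed.

Lemma pcm_act_linear_l a u v f : act (a *: u + v) f = a *: act u f + act v f.
Proof.
rewrite /pcm_act scaler_sumr -big_split /=; apply: eq_bigr => m _.
by rewrite pcm_act_mon_linear scalerDr !scalerA mulrC.
Qed.

Lemma pcm_actXm u m : act u 'X_[m] = pcm_act_mon u m.
Proof. by rewrite /pcm_act msuppX big_seq1 mcoeffX eqxx scale1r. Qed.

Lemma pcm_act1 u : act u 1 = u.
Proof. by rewrite -mpolyX0 pcm_actXm pcm_act_mon0. Qed.

Lemma pcm_actX u i : act u 'X_i = [lie u, pcm_gen i].
Proof. by rewrite pcm_actXm pcm_act_mon1. Qed.

Lemma pcm_act_derived u f : derived u -> derived (act u f).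
Proof.
move=> Du; have [D0 DZD] := @derived_submodule R pcm.
rewrite /pcm_act; elim: (msupp f) => [|m s IHs]; rewrite ?big_nil ?big_cons //.
by apply: DZD IHs; apply: derived_acts.
Qed.

Lemma pcm_actM u f g : derived u -> act u (f * g) = act (act u f) g.
Proof.
move=> Du.
have act0 v : act v 0 = 0 by rewrite /pcm_act msupp0 big_nil.
have act0l h : act 0 h = 0.
  by apply: (@addrI _ (act 0 h)); rewrite -{1}[act 0 h]scale1r
    -pcm_act_linear_l scale1r !addr0.
have actS (s : seq 'X_{1..n}) (c : 'X_{1..n} -> R) v p :
    act v (\sum_(m <- s) c m *: (p m : {mpoly R[n]}))
    = \sum_(m <- s) c m *: act v (p m).
  by elim: s => [|m s IHs]; rewrite ?big_nil // !big_cons pcm_act_linear_r IHs.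
rewrite {1}[f]mpolyE mulr_suml.
under eq_bigr do rewrite -scalerAl.
rewrite actS {3}/pcm_act.
elim: (msupp f) => [|m s IHs]; rewrite ?big_nil ?act0l // !big_cons.
rewrite pcm_act_linear_l -IHs; congr (_ *: _ + _).
rewrite {1 2}[g]mpolyE mulr_sumr.
under eq_bigr do rewrite -scalerAr -mpolyXD.
rewrite !actS; apply: eq_bigr => m' _.
by rewrite !pcm_actXm pcm_act_monD.
Qed.

End PartiallyCommutative.

Definition simple_graph (n : nat) (G : rel 'I_n) : Prop :=
  ssrbool.symmetric G /\ irreflexive G.

Definition neighbours (n : nat) (G : rel 'I_n) (x : 'I_n) : {set 'I_n} :=
  [set y | G x y].

Definition degree (n : nat) (G : rel 'I_n) (x : 'I_n) : nat :=
  #|neighbours G x|.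

Definition isolated (n : nat) (G : rel 'I_n) (x : 'I_n) : Prop :=
  neighbours G x = set0.

(* Main.v *)
Require Import Defs.
From HB Require Import structures.
From mathcomp Require Import all_boot all_algebra.
From mathcomp Require Import boolp functions.
From mathcomp Require Import mpoly.

Set Implicit Arguments.
Unset Strict Implicit.
Unset Printing Implicit Defensive.

Import GRing.Theory.
Local Open Scope ring_scope.

(** Let z = x_n, let N be the set of neighbours of z, and let S be the ideal
    of M(X;G) generated by the brackets of two elements of N.  An element of S
    is killed by z by the Jacobi identity, and S consists of the sums of
    [x_i, x_j].f with i, j in N and f free of z.  The heart of the matter is the
    converse: an element w of the derived subalgebra with [w, z] = 0 is in S.

    For this, multiplication by z is inverted modulo S: there is an R-linear
    map phi from M(X;G) to M(X;G)/S such that phi [w, z] = w mod S for all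
    w in the derived subalgebra ([pcm_division]).  On the generators
    [x_i, x_j].mu of M', with mu a monomial, phi removes a factor z from mu when
    there is one.  When there is none, phi is 0 for i, j different from z; but on
    [x_i, z].mu it cannot always be 0: if z does not divide mu, the Jacobi
    identity [x_j, z].(mu x_i) - [x_i, z].(mu x_j) = - [x_i, x_j].(mu z) forces
    a value, and finding consistent ones is the same as writing down a
    contracting homotopy in low degree of the Koszul complex of the variables
    other than z.  The homotopy that lowers the largest variable x_p of mu sends
    [x_i, z].mu to [x_i, x_p].(mu / x_p) if i < p and to 0 otherwise
    ([top_homotopyP]).  If i is in N, then [x_i, z] = 0 and the value has to be
    0 as well: this holds modulo S, provided that N is a final segment of the
    vertices other than z, for then p is in N too.  In all three cases of the
    theorem N is such a segment.

    A map like phi, defined by its values on the [x_i, x_j].mu, has to be shown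
    to exist on M(X;G), which is given by generators and relations.  Values
    satisfying the alternating and Jacobi identities ([cocycle]) and vanishing
    on the edges are realised by a morphism from M(X;G) to a metabelian Lie
    algebra, an extension of R^n by the functions on the monomials
    ([pcm_cocycle_functional]).

    The same tool yields the coordinates of the degree two part of M(X;G) with
    respect to the nonedges ([pcm_nonedge_functional]); they show that the
    linear part of a centralizing element only involves N and z.  All
    this gives the centralizer in one formula ([centralizerE]), of which the three
    cases are specialisations. *)

(** * Submodules, Lie morphisms and monomials *)

Section Submodule.
Variables (R : comNzRingType) (W : lmodType R) (P : W -> Prop).
Hypothesis subP : is_submodule P.

Lemma submodule0 : P 0. Proof. by case: subP. Qed.
Lemma submoduleZD (a : R) u v : P u -> P v -> P (a *: u + v).
Proof. by case: subP => _; apply. Qed.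
Lemma submoduleZ (a : R) u : P u -> P (a *: u).
Proof. by move=> Pu; rewrite -[_ *: u]addr0; apply: submoduleZD submodule0. Qed.
Lemma submoduleD u v : P u -> P v -> P (u + v).
Proof. by move=> Pu; rewrite -[u]scale1r; apply: submoduleZD. Qed.
Lemma submoduleN u : P u -> P (- u).
Proof. by rewrite -scaleN1r; apply: submoduleZ. Qed.
Lemma submodule_sum I (s : seq I) (Q : pred I) (F : I -> W) :
  (forall i, Q i -> P (F i)) -> P (\sum_(i <- s | Q i) F i).
Proof.
by move=> PF; elim/big_ind: _ => //; [exact: submodule0 | exact: submoduleD].
Qed.
End Submodule.

Lemma linear_map0 (R : comNzRingType) (U W : lmodType R) (phi : U -> W) :
  (forall (a : R) u v, phi (a *: u + v) = a *: phi u + phi v) -> phi 0 = 0.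
Proof.
by move=> phiZD; have := phiZD (-1) 0 0; rewrite scaler0 addr0 scaleN1r addNr.
Qed.

Section Morphism.
Variables (R : comNzRingType) (L L' : lieAlgType R) (f : L -> L').
Hypothesis fM : lie_morphism f.

Lemma lie_morphismZD (a : R) u v : f (a *: u + v) = a *: f u + f v.
Proof. by case: fM. Qed.
Lemma lie_morphismB u v : f [lie u, v] = [lie f u, f v].
Proof. by case: fM. Qed.
Lemma lie_morphism0 : f 0 = 0.
Proof. by rewrite -(bracketxx (0 : L)) lie_morphismB bracketxx. Qed.
Lemma lie_morphismD u v : f (u + v) = f u + f v.
Proof. by rewrite -[u]scale1r lie_morphismZD !scale1r. Qed.
Lemma lie_morphismZ (a : R) u : f (a *: u) = a *: f u.
Proof. by rewrite -[a *: u]addr0 lie_morphismZD lie_morphism0 addr0. Qed.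

Lemma lie_morphism_ker_ideal : is_ideal (fun u => f u = 0).
Proof.
split=> [|u v fu]; last by rewrite lie_morphismB fu bracket0l.
split=> [|a u v fu fv]; first exact: lie_morphism0.
by rewrite lie_morphismZD fu fv scaler0 addr0.
Qed.
End Morphism.

Section BracketSum.
Variables (R : comNzRingType) (L : lieAlgType R).

Lemma bracket_suml I (s : seq I) (P : pred I) (F : I -> L) (v : L) :
  [lie \sum_(i <- s | P i) F i, v] = \sum_(i <- s | P i) [lie F i, v].
Proof.
by apply: (big_morph (fun u => [lie u, v])) => [u w|];
  [exact: bracketDl | exact: bracket0l].
Qed.

Lemma bracket_sumr I (s : seq I) (P : pred I) (F : I -> L) (v : L) :
  [lie v, \sum_(i <- s | P i) F i] = \sum_(i <- s | P i) [lie v, F i].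
Proof.
by apply: (big_morph (fun u => [lie v, u])) => [u w|];
  [exact: bracketDr | exact: bracket0r].
Qed.

End BracketSum.

Lemma mnm_ind n (P : 'X_{1..n} -> Prop) :
  P 0%MM -> (forall mu i, P mu -> P (mu + U_(i))%MM) -> forall mu, P mu.
Proof.
move=> P0 PS mu; have [d] := ubnP (mdeg mu); elim: d mu => // d IHd mu lt_mu.
have [->//|mu_neq0] := eqVneq mu 0%MM.
have [i mu_i] : exists i, (0 < mu i)%N.
  apply/existsP; apply: contraNT mu_neq0; rewrite negb_exists => /forallP mu0.
  by apply/eqP/mnmP => i; rewrite mnm0E; move: (mu0 i); case: (mu i).
have le_i : (U_(i) <= mu)%MM by rewrite lep1mP -lt0n.
rewrite -(submK le_i); apply/PS/IHd.
by rewrite -{1}(submK le_i) mdegD mdeg1 addn1 in lt_mu.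
Qed.

(** * The metabelian Lie algebra of a cocycle *)

Section CocycleExtension.
Variables (R : comNzRingType) (n : nat) (V : lmodType R).
Local Notation mon := 'X_{1..n}.

(** These are the identities satisfied by the family [[x_i, x_j].mu]: the last
    one is the Jacobi identity of three generators, acted on by [mu].  Only the
    values at monomials are recorded, so that a cocycle may take its values in
    a mere R-module. *)
Record cocycle := Cocycle {
  cocycle_val :> 'I_n -> 'I_n -> mon -> V;
  cocycle_alt : forall i mu, cocycle_val i i mu = 0;
  cocycle_antisym : forall i j mu, cocycle_val i j mu = - cocycle_val j i mu;
  cocycle_jacobi : forall i j k mu,
    cocycle_val i j (mu + U_(k))%MM + cocycle_val j k (mu + U_(i))%MM
      + cocycle_val k i (mu + U_(j))%MM = 0
}.

Lemma fun_addE (F H : mon -> V) mu : (F + H) mu = F mu + H mu.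
Proof. by []. Qed.
Lemma fun_scaleE s (F : mon -> V) mu : (s *: F) mu = s *: F mu.
Proof. by []. Qed.
Lemma fun_oppE (F : mon -> V) mu : (- F) mu = - F mu.
Proof. by []. Qed.
Lemma fun_zeroE mu : (0 : mon -> V) mu = 0.
Proof. by []. Qed.
Let funE := (fun_addE, fun_scaleE, fun_oppE).

(** The coinduced action: the variable x_k translates a function of monomials
    by x_k, and [a] stands for the linear form with coefficients [a]. *)
Definition shift_act (a : 'rV[R]_n) (F : mon -> V) : mon -> V :=
  fun mu => \sum_k a 0 k *: F (mu + U_(k))%MM.

Definition cocycle_form (c : cocycle) (a b : 'rV[R]_n) : mon -> V :=
  fun mu => \sum_i \sum_j (a 0 i * b 0 j) *: c i j mu.

Lemma shift_act_linear_l s a b F :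
  shift_act (s *: a + b) F = s *: shift_act a F + shift_act b F.
Proof.
apply: funext => mu; rewrite !funE /shift_act scaler_sumr -big_split /=.
by apply: eq_bigr => k _; rewrite !mxE scalerDl scalerA.
Qed.

Lemma shift_act_linear_r s a F H :
  shift_act a (s *: F + H) = s *: shift_act a F + shift_act a H.
Proof.
apply: funext => mu; rewrite !funE /shift_act scaler_sumr -big_split /=.
apply: eq_bigr => k _; rewrite !funE /= scalerDr !scalerA.
by rewrite mulrC.
Qed.

Lemma shift_act0 F : shift_act 0 F = 0.
Proof.
by apply: funext => mu; rewrite /shift_act big1 // => k _; rewrite mxE scale0r.
Qed.

Lemma shift_actD a F H : shift_act a (F + H) = shift_act a F + shift_act a H.
Proof. by rewrite -[F]scale1r shift_act_linear_r !scale1r. Qed.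

Lemma shift_actN a F : shift_act a (- F) = - shift_act a F.
Proof.
apply: funext => mu; rewrite funE /shift_act -sumrN.
by apply: eq_bigr => k _; rewrite funE scalerN.
Qed.

Lemma shift_actC a b F :
  shift_act a (shift_act b F) = shift_act b (shift_act a F).
Proof.
apply: funext => mu; rewrite /shift_act.
under eq_bigr do rewrite scaler_sumr.
rewrite exchange_big; apply: eq_bigr => k _ /=.
rewrite scaler_sumr; apply: eq_bigr => l _.
by rewrite !scalerA mulrC -!addmA [(U_(k) + _)%MM]addmC.
Qed.

Lemma shift_act_delta k F mu :
  shift_act (delta_mx 0 k) F mu = F (mu + U_(k))%MM.
Proof.
rewrite /shift_act (bigD1 k) //= big1 ?mxE ?eqxx ?scale1r ?addr0 // => l lk.
by rewrite mxE (negPf lk) andbF scale0r.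
Qed.

Variable c : cocycle.

Lemma cocycle_form_linear_l s a b d :
  cocycle_form c (s *: a + b) d = s *: cocycle_form c a d + cocycle_form c b d.
Proof.
apply: funext => mu; rewrite !funE /cocycle_form scaler_sumr -big_split /=.
apply: eq_bigr => i _; rewrite scaler_sumr -big_split /=; apply: eq_bigr => j _.
by rewrite !mxE scalerA -scalerDl mulrDl mulrA.
Qed.

Lemma cocycle_form_antisym a b : cocycle_form c a b = - cocycle_form c b a.
Proof.
apply: funext => mu; rewrite !funE /cocycle_form -sumrN exchange_big.
apply: eq_bigr => i _; rewrite -sumrN; apply: eq_bigr => j _.
by rewrite cocycle_antisym scalerN mulrC.
Qed.

(** The characteristic may be 2, so antisymmetry does not suffice: the diagonal
    terms vanish on their own and the others are paired off. *)
Lemma cocycle_form_alt a : cocycle_form c a a = 0.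
Proof.
apply: funext => mu; rewrite /cocycle_form /=.
have split_sum (g : 'I_n -> 'I_n -> V) : (forall i, g i i = 0) ->
  \sum_i \sum_j g i j = \sum_(i < n) \sum_(j < n | (i < j)%N) (g i j + g j i).
  move=> g0; under [RHS]eq_bigr do rewrite big_split /=.
  rewrite big_split /=.
  rewrite [X in _ + X](exchange_big_dep (fun _ : 'I_n => true)) //=.
  rewrite -big_split /=.
  apply: eq_bigr => i _; rewrite (bigID (fun j : 'I_n => (i < j)%N)) /=.
  congr (_ + _); rewrite (bigD1 i) ?ltnn //= g0 add0r.
  apply: eq_bigl => j; rewrite -leqNgt ltn_neqAle andbC.
  by rewrite -val_eqE.
rewrite split_sum => [|i]; last by rewrite cocycle_alt scaler0.
rewrite big1 // => i _; rewrite big1 // => j _.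
by rewrite (cocycle_antisym c j) scalerN mulrC subrr.
Qed.

Lemma cocycle_form_delta i j :
  cocycle_form c (delta_mx 0 i) (delta_mx 0 j) = c i j.
Proof.
apply: funext => mu; rewrite /cocycle_form (bigD1 i) //= (bigD1 j) //=.
rewrite !mxE !eqxx mul1r scale1r !big1 ?addr0 // => [k ki|k kj].
  by rewrite big1 // => l _; rewrite !mxE (negPf ki) mul0r scale0r.
by rewrite !mxE (negPf kj) mulr0 scale0r.
Qed.

Lemma cocycle_form_jacobi a b d :
  shift_act d (cocycle_form c a b) + shift_act a (cocycle_form c b d)
    + shift_act b (cocycle_form c d a) = 0.
Proof.
apply: funext => mu; rewrite !funE /shift_act /cocycle_form /=.
have E (p q s : 'rV[R]_n) : \sum_k s 0 k *: (\sum_i \sum_j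
      (p 0 i * q 0 j) *: c i j (mu + U_(k))%MM)
    = \sum_i \sum_j \sum_k (p 0 i * q 0 j * s 0 k) *: c i j (mu + U_(k))%MM.
  under eq_bigr do rewrite scaler_sumr.
  rewrite exchange_big; apply: eq_bigr => i _ /=.
  under eq_bigr do rewrite scaler_sumr.
  rewrite exchange_big; apply: eq_bigr => j _ /=.
  by apply: eq_bigr => k _; rewrite scalerA mulrC.
(* The three sums are brought to one order of summation; the cocycle identity
   then kills the terms one by one. *)
rewrite !E.
under [X in _ + X + _]eq_bigr do rewrite exchange_big /=.
rewrite [X in _ + X + _]exchange_big [X in _ + _ + X]exchange_big /=.
under [X in _ + _ + X]eq_bigr do rewrite exchange_big /=.
rewrite -!big_split big1 //= => i _.
rewrite -!big_split big1 //= => j _.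
rewrite -!big_split big1 //= => k _.
rewrite [b 0 j * _ * _]mulrC mulrA -[d 0 k * _ * _]mulrA [d 0 k * _]mulrC.
by rewrite -!scalerDr cocycle_jacobi scaler0.
Qed.

(** The extension of the abelian Lie algebra R^n by the coinduced module that
    the cocycle defines; ideal and quotient are abelian, hence it is
    metabelian. *)
Definition cocycle_ext of cocycle : Type := ('rV[R]_n * (mon -> V))%type.

HB.instance Definition _ :=
  GRing.Lmodule.copy (cocycle_ext c) ('rV[R]_n * (mon -> V))%type.

Definition cocycle_bracket (u v : cocycle_ext c) : cocycle_ext c :=
  (0, cocycle_form c u.1 v.1 + shift_act v.1 u.2 - shift_act u.1 v.2).

Lemma cocycle_ext_eq (u v : cocycle_ext c) : u.1 = v.1 -> u.2 = v.2 -> u = v.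
Proof. by case: u v => [a F] [b H] /= -> ->. Qed.

Lemma cocycle_ext_linE (s : R) (u v : cocycle_ext c) :
  ((s *: u + v).1 = s *: u.1 + v.1) * ((s *: u + v).2 = s *: u.2 + v.2).
Proof. by []. Qed.

Lemma cocycle_form0l a : cocycle_form c 0 a = 0.
Proof.
apply: (@linear_map0 _ _ _ (fun b => cocycle_form c b a)) => s b d.
exact: cocycle_form_linear_l.
Qed.

Lemma cocycle_bracketC u v : cocycle_bracket u v = - cocycle_bracket v u.
Proof.
apply: cocycle_ext_eq => /=; first by rewrite oppr0.
by rewrite cocycle_form_antisym -!addrA opprD opprD opprK [X in _ + X]addrC.
Qed.

Lemma cocycle_bracketPl (s : R) (u v w : cocycle_ext c) :
  cocycle_bracket (s *: u + v) w =
    s *: cocycle_bracket u w + cocycle_bracket v w.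
Proof.
apply: cocycle_ext_eq; rewrite cocycle_ext_linE /=.
  by rewrite scaler0 addr0.
rewrite cocycle_form_linear_l shift_act_linear_l shift_act_linear_r.
by rewrite !scalerDr scalerN opprD [RHS]addrACA; congr (_ + _); rewrite addrACA.
Qed.

Lemma cocycle_bracketPr (s : R) (u v w : cocycle_ext c) :
  cocycle_bracket w (s *: u + v) =
    s *: cocycle_bracket w u + cocycle_bracket w v.
Proof.
rewrite cocycle_bracketC cocycle_bracketPl opprD -scalerN.
by rewrite -!cocycle_bracketC.
Qed.

Lemma cocycle_bracketxx u : cocycle_bracket u u = 0.
Proof.
by apply: cocycle_ext_eq; rewrite //= cocycle_form_alt add0r subrr.
Qed.

Lemma cocycle_bracket_jacobi u v w :
  cocycle_bracket (cocycle_bracket u v) w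
    + cocycle_bracket (cocycle_bracket v w) u
    + cocycle_bracket (cocycle_bracket w u) v = 0.
Proof.
apply: cocycle_ext_eq; first by rewrite /= !addr0.
rewrite /= -(cocycle_form_jacobi u.1 v.1 w.1).
rewrite !cocycle_form0l !shift_act0 !add0r !subr0 !shift_actD !shift_actN.
rewrite (shift_actC u.1 w.1) (shift_actC v.1 u.1) (shift_actC w.1 v.1).
set A := shift_act w.1 (cocycle_form c _ _).
set B := shift_act u.1 (cocycle_form c _ _).
set D := shift_act v.1 (cocycle_form c _ _).
set X := shift_act _ _; set Y := shift_act _ _; set Z := shift_act _ _.
rewrite -(addrA A) -(addrA B) -(addrA D) (addrACA A) (addrACA (A + B)).
by rewrite [_ - _ + (_ - _)]addrA subrK [_ - _ + (_ - _)]addrA subrK subrr addr0.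
Qed.

HB.instance Definition _ := Lmodule_isLieAlgebra.Build R (cocycle_ext c)
  cocycle_bracketPl cocycle_bracketPr cocycle_bracketxx cocycle_bracket_jacobi.

Lemma cocycle_ext_metabelian : metabelian (cocycle_ext c).
Proof.
move=> u v w z; apply: cocycle_ext_eq => //=.
by rewrite cocycle_form0l !shift_act0 add0r subrr.
Qed.

End CocycleExtension.

(** * Linear functionals on M(X;G) and its monomial generators *)

Section Spanning.
Variables (R : comNzRingType) (n : nat) (G : rel 'I_n).
Local Notation M := (pcm R G).
Local Notation x := (pcm_gen R G).

Lemma pcm_universal (L : lieAlgType R) (f : 'I_n -> L) :
  metabelian L -> (forall k l, G k l -> [lie f k, f l] = 0) ->
  exists g : M -> L, lie_morphism g /\ forall k, g (x k) = f k.
Proof.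
move=> Lmet fG; have [g [gM gX _]] := free_metabelian_universal Lmet f.
have g0 u : ideal_gen (edge_relators G) u -> g u = 0.
  move/(_ (fun u => g u = 0)); apply; first exact: lie_morphism_ker_ideal.
  by move=> _ [k [l [Gkl ->]]]; rewrite lie_morphismB // !gX fG.
have gE u : g (repr (lie_proj (edge_relators G) u)) = g u.
  have /g0 : ideal_gen (edge_relators (R := R) G)
      (repr (lie_proj (edge_relators G) u) - u).
    by apply/lie_proj_eq; rewrite lie_projK.
  by rewrite addrC -scaleN1r lie_morphismZD // scaleN1r addrC => /subr0_eq.
have pM := lie_proj_morphism (edge_relators (R := R) G).
exists (fun u : M => g (repr (u : lie_quot _))).
split=> [|k]; last by rewrite gE.
split=> [a u v|u v]; rewrite -[u in LHS]lie_projK -[v in LHS]lie_projK.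
  by rewrite -(lie_morphismZD pM) gE lie_morphismZD.
by rewrite -(lie_morphismB pM) gE lie_morphismB.
Qed.

Lemma pcm_ind (P : M -> Prop) :
  is_submodule P -> (forall k, P (x k)) ->
  (forall u v, P u -> P v -> P [lie u, v]) -> forall u, P u.
Proof.
move=> subP PX PB u.
have [pM pB] := lie_proj_morphism (edge_relators (R := R) G).
have pM' := conj pM pB.
rewrite -[u]lie_projK -[repr u]cls_repr.
elim: (repr (repr u)) => {u} [k||t Pt s Ps|t Pt|a t Pt|t Pt s Ps].
- exact: PX.
- by move: (submodule0 subP); rewrite -[X in P X -> _](lie_morphism0 pM').
- by rewrite -cls_addE (lie_morphismD pM'); apply: submoduleD.
- by rewrite -cls_oppE -scaleN1r (lie_morphismZ pM'); apply: submoduleZ.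
- by rewrite -cls_scaleE (lie_morphismZ pM'); apply: submoduleZ.
- by rewrite -cls_bracketE pB; apply: PB.
Qed.

(** The substitute for a presentation of M'(X;G): a linear map on M may be
    prescribed on the elements [x_i, x_j].mu by any cocycle that vanishes on
    the edges.  It need not be R[X]-linear, but it becomes so once w is sent to
    the function mu |-> phi (w.mu); this is why functions of monomials form the
    abelian ideal of [cocycle_ext].  The morphism of M to that extension sends
    [x_i, x_j].mu to the translate of c i j by mu, and phi is the value of its
    second component at the monomial 1. *)
Lemma pcm_cocycle_functional (V : lmodType R) (c : cocycle n V) :
  (forall k l mu, G k l -> c k l mu = 0) ->
  exists phi : M -> V,
    [/\ forall a u v, phi (a *: u + v) = a *: phi u + phi v,
        forall k, phi (x k) = 0 &
        forall i j mu, phi (pcm_act_mon [lie x i, x j] mu) = c i j mu].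
Proof.
move=> cG; pose f k : cocycle_ext c := (delta_mx 0 k, 0).
have fB k l : [lie f k, f l] = (0, c k l) :> cocycle_ext c.
  apply: cocycle_ext_eq => //=.
  rewrite cocycle_form_delta; apply: funext => mu.
  by rewrite !fun_addE fun_oppE !shift_act_delta !fun_zeroE subr0 addr0.
have [k l Gkl|g [gM gX]] :=
    pcm_universal (f := f) (@cocycle_ext_metabelian _ _ _ c).
  by rewrite fB; apply: cocycle_ext_eq => //; apply: funext => mu; apply: cG.
exists (fun u => (g u).2 0%MM); split=> [a u v|k|i j mu].
- by rewrite lie_morphismZD.
- by rewrite gX.
suff -> : g (pcm_act_mon [lie x i, x j] mu)
        = (0, fun nu => c i j (nu + mu)%MM) :> cocycle_ext c by rewrite /= add0m.
elim/mnm_ind: mu => [|mu k IHmu].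
  rewrite pcm_act_mon0 lie_morphismB // !gX fB; apply: cocycle_ext_eq => //=.
  by apply: funext => nu; rewrite addm0.
rewrite pcm_act_monD; last exact: derived_bracket.
rewrite pcm_act_mon1 lie_morphismB // IHmu gX; apply: cocycle_ext_eq => //=.
rewrite cocycle_form0l shift_act0 add0r subr0; apply: funext => nu.
by rewrite shift_act_delta -addmA [(U_(k) + _)%MM]addmC.
Qed.

Lemma pcm_derived_bracket0 (u v : M) : derived u -> derived v -> [lie u, v] = 0.
Proof.
move=> Du Dv; apply: (Du (fun u => [lie u, v] = 0)) => [|a b].
  split=> [|s a b a0 b0]; first exact: bracket0l.
  by rewrite bracketPl a0 b0 scaler0 addr0.
apply: (Dv (fun v => [lie [lie a, b], v] = 0)); last exact: pcm_metabelian.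
split=> [|s d e d0 e0]; first exact: bracket0r.
by rewrite bracketPr d0 e0 scaler0 addr0.
Qed.

(** The R-span of the elements [x_i, x_j].mu.  It is shown to be the derived
    subalgebra by decomposing all of M first: a bracket of two decomposed
    elements falls into the span, because the span itself is abelian. *)
Definition monomial_span (u : M) : Prop :=
  forall P : M -> Prop, is_submodule P ->
  (forall i j mu, P (pcm_act_mon [lie x i, x j] mu)) -> P u.

Lemma monomial_span_submodule : is_submodule monomial_span.
Proof.
split=> [P subP _|a v w Sv Sw P subP PX]; first exact: submodule0.
by apply: submoduleZD => //; [apply: Sv | apply: Sw].
Qed.
Let subS := monomial_span_submodule.

Lemma monomial_span_mon i j mu :
  monomial_span (pcm_act_mon [lie x i, x j] mu).
Proof. by move=> P _; apply. Qed.

Lemma monomial_span_derived v : monomial_span v -> derived v.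
Proof.
move=> Sv; apply: (Sv (@derived R M)) => [|i j mu].
  exact: derived_submodule.
rewrite -pcm_actXm; apply: pcm_act_derived; exact: derived_bracket.
Qed.

Lemma monomial_span_gen v k : monomial_span v -> monomial_span [lie v, x k].
Proof.
move=> Sv; apply: (Sv (fun v => monomial_span [lie v, x k])) => [|i j mu].
  split=> [|a w z Sw Sz]; first by rewrite bracket0l; apply: (submodule0 subS).
  by rewrite bracketPl; apply: (submoduleZD subS).
rewrite -pcm_act_mon1 -pcm_act_monD; last exact: derived_bracket.
exact: monomial_span_mon.
Qed.

Lemma monomial_span_linear v (a : 'I_n -> R) :
  monomial_span v -> monomial_span [lie v, \sum_k a k *: x k].
Proof.
move=> Sv; elim/big_ind: _ => [|w z Sw Sz|k _].
- by rewrite bracket0r; apply: (submodule0 subS).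
- by rewrite bracketDr; apply: (submoduleD subS).
- by rewrite bracketZr; apply: (submoduleZ subS); apply: monomial_span_gen.
Qed.

Lemma monomial_span_linear2 (a b : 'I_n -> R) :
  monomial_span [lie \sum_k a k *: x k, \sum_k b k *: x k].
Proof.
have : forall k, monomial_span [lie x k, \sum_l b l *: x l].
  move=> k; elim/big_ind: _ => [|w z Sw Sz|l _].
  - by rewrite bracket0r; apply: (submodule0 subS).
  - by rewrite bracketDr; apply: (submoduleD subS).
  rewrite bracketZr; apply: (submoduleZ subS).
  by rewrite -[[lie _, _]]pcm_act_mon0; apply: monomial_span_mon.
move: (\sum_l b l *: x l) => w Sxw; elim/big_ind: _ => [|u v Su Sv|k _].
- by rewrite bracket0l; apply: (submodule0 subS).
- by rewrite bracketDl; apply: (submoduleD subS).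
- by rewrite bracketZl; apply: (submoduleZ subS); apply: Sxw.
Qed.

Lemma monomial_span_bracket (a b : 'I_n -> R) s t :
  monomial_span s -> monomial_span t ->
  monomial_span [lie \sum_k a k *: x k + s, \sum_k b k *: x k + t].
Proof.
move=> Ss St.
rewrite bracketDl !bracketDr [X in _ + (_ + X)]pcm_derived_bracket0 ?addr0;
  try exact: monomial_span_derived.
apply: (submoduleD subS); last exact: monomial_span_linear.
apply: (submoduleD subS); first exact: monomial_span_linear2.
by rewrite bracketC; apply: (submoduleN subS); apply: monomial_span_linear.
Qed.

Lemma pcm_decomposition v :
  exists (a : 'I_n -> R) w, monomial_span w /\ v = \sum_k a k *: x k + w.
Proof.
move: v; apply: pcm_ind => [|k|v w [a [s [Ss ->]]] [b [t [St ->]]]].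
- split=> [|c v w [a [s [Ss ->]]] [b [t [St ->]]]].
    exists (fun=> 0), 0; split; first exact: (submodule0 subS).
    by rewrite addr0 big1 // => k _; rewrite scale0r.
  exists (fun k => c * a k + b k), (c *: s + t).
  split; first exact: (submoduleZD subS).
  rewrite scalerDr addrACA scaler_sumr -big_split /=; congr (_ + _).
  by apply: eq_bigr => k _; rewrite scalerDl scalerA.
- exists (fun l => (l == k)%:R), 0; split; first exact: (submodule0 subS).
  rewrite addr0 (bigD1 k) //= eqxx scale1r big1 ?addr0 // => l /negPf ->.
  by rewrite scale0r.
exists (fun=> 0), [lie \sum_k a k *: x k + s, \sum_k b k *: x k + t].
split; last first.
  rewrite -[LHS]add0r; congr (_ + _).
  by rewrite big1 // => k _; rewrite scale0r.
exact: monomial_span_bracket.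
Qed.

Lemma derived_monomial_span v : derived v -> monomial_span v.
Proof.
move=> Dv; apply: (Dv monomial_span) => [|u w].
  exact: monomial_span_submodule.
have [a [s [Ss ->]]] := pcm_decomposition u.
have [b [t [St ->]]] := pcm_decomposition w.
exact: monomial_span_bracket.
Qed.

Lemma pcm_act_monDl (u v : M) mu :
  pcm_act_mon (u + v) mu = pcm_act_mon u mu + pcm_act_mon v mu.
Proof. by rewrite -[u]scale1r pcm_act_mon_linear !scale1r. Qed.

Lemma pcm_act_mon0l mu : pcm_act_mon (0 : M) mu = 0.
Proof.
by apply: (@addrI _ (pcm_act_mon (0 : M) mu)); rewrite -pcm_act_monDl !addr0.
Qed.

Lemma pcm_act_monNl (u : M) mu : pcm_act_mon (- u) mu = - pcm_act_mon u mu.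
Proof.
by apply/eqP; rewrite -addr_eq0 -pcm_act_monDl addNr pcm_act_mon0l.
Qed.

Lemma pcm_act0r (u : M) : pcm_act u 0 = 0.
Proof. by rewrite /pcm_act msupp0 big_nil. Qed.

Lemma pcm_act0l f : pcm_act (0 : M) f = 0.
Proof. by rewrite /pcm_act big1 // => mu _; rewrite pcm_act_mon0l scaler0. Qed.

End Spanning.

(** * Dividing a cocycle by the last variable *)

Section Division.
Variables (R : comNzRingType) (m : nat) (V : lmodType R).
Variable e : cocycle m.+1 V.
Local Notation mon := 'X_{1..m.+1}.
Implicit Types (i j k l p : 'I_m.+1) (mu nu xi : mon).

Let addmAC mu nu xi : (mu + nu + xi)%MM = (mu + xi + nu)%MM :> mon.
Proof. by rewrite -!addmA [(nu + _)%MM]addmC. Qed.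

(** The last variable, here x_m, is set apart: the order of the variables is
    only ever used on the others. *)
Definition top_var mu p :=
  [&& (p < m)%N, (0 < mu p)%N &
      [forall l : 'I_m.+1, (p < l < m)%N ==> (mu l == 0)]].

(** The contracting homotopy of the Koszul complex of x_0, ..., x_(m-1) that
    lowers the top variable of the monomial: in degree one it sends a_i mu to
    a_i a_p (mu / x_p) if the top variable x_p of mu comes after x_i and to 0
    otherwise, where a_i a_p is read as [e i p]. *)
Definition top_homotopy i mu : V :=
  if [pick p : 'I_m.+1 | (i < p)%N && top_var mu p] is Some p
  then e i p (mu - U_(p))%MM else 0.

Lemma top_var_unique mu p l : top_var mu p -> top_var mu l -> p = l.
Proof.
case/and3P=> lt_pm mu_p /forallP/= top_p /and3P[lt_lm mu_l /forallP/= top_l].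
apply/val_inj; case: (ltngtP p l) => // lt_pl.
  by move: (top_p l); rewrite lt_pl lt_lm; case: (mu l) mu_l.
by move: (top_l p); rewrite lt_pl lt_pm; case: (mu p) mu_p.
Qed.

Lemma top_homotopyE i p mu :
  (i < p)%N -> top_var mu p -> top_homotopy i mu = e i p (mu - U_(p))%MM.
Proof.
move=> lt_ip top_p; rewrite /top_homotopy; case: pickP => [l|/(_ p)].
  by case/andP=> _ /top_var_unique/(_ top_p) ->.
by rewrite lt_ip top_p.
Qed.

Lemma top_homotopy0 i mu :
  (forall l, (i < l < m)%N -> mu l = 0%N \/ forall nu, e i l nu = 0) ->
  top_homotopy i mu = 0.
Proof.
move=> mu0; rewrite /top_homotopy; case: pickP => // p.
case/and4P=> lt_ip lt_pm mu_p _; have [|mu_p0|->//] := mu0 p.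
  by rewrite lt_ip.
by rewrite mu_p0 in mu_p.
Qed.

Lemma top_varP i mu :
  {p : 'I_m.+1 | (i < p)%N & top_var mu p}
  + {forall l, (i < l < m)%N -> mu l = 0%N}.
Proof.
pose P (p : 'I_m.+1) := (i < p < m)%N && (0 < mu p)%N.
case: (pickP P) => [p0 Pp0|no_p].
  left; case: (@arg_maxnP _ p0 P (@nat_of_ord m.+1) Pp0) => p.
  case/andP=> [/andP[lt_ip lt_pm] mu_p] max_p; exists p => //.
  apply/and3P; split=> //; apply/forallP=> l.
  apply/implyP=> /andP[lt_pl lt_lm]; rewrite -leqn0 leqNgt; apply/negP=> mu_l.
  have /max_p : P l.
    by rewrite /P (ltn_trans lt_ip lt_pl) lt_lm.
  by move=> le_lp; have := leq_trans lt_pl le_lp; rewrite ltnn.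
right=> l lt_il; move: (no_p l); rewrite /P lt_il /=.
by case: (mu l).
Qed.

(** The homotopy recovers e i j mu from its Koszul boundary.  For j < i, either
    the top variable x_p of mu comes after both and this is the cocycle identity
    for i, j, p at mu / x_p; or x_i is the top variable of mu x_i, and of the two
    homotopy terms only the one of a_j (mu x_i) is nonzero, with value
    e j i mu. *)
Lemma top_homotopyP i j mu : (i < m)%N -> (j < m)%N ->
  e i j mu + top_homotopy j (mu + U_(i))%MM - top_homotopy i (mu + U_(j))%MM = 0.
Proof.
wlog lt_ji: i j / (j < i)%N => [H lt_im lt_jm|lt_im lt_jm].
  case: (ltngtP j i) => [lt_ji|lt_ij|/val_inj ->]; first exact: H.
    apply/eqP; rewrite -oppr_eq0 !opprD opprK -(cocycle_antisym e j i) addrAC.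
    by rewrite H.
  by rewrite cocycle_alt add0r subrr.
have [[p lt_ip top_p]|mu0] := top_varP i mu.
  have [lt_pm mu_p /forallP/= max_p] := and3P top_p.
  have top_add k : (k < p)%N -> top_var (mu + U_(k))%MM p.
    move=> lt_kp; apply/and3P; split=> //; first by rewrite mnmDE ltn_addr.
    apply/forallP=> l; apply/implyP=> lt_pl; rewrite mnmDE mnm1E addn_eq0.
    rewrite (implyP (max_p l) lt_pl) /= eqb0; apply/negP=> /eqP kl.
    by rewrite -kl ltnNge (ltnW lt_kp) in lt_pl.
  rewrite (top_homotopyE (ltn_trans lt_ji lt_ip)) ?top_add //.
  rewrite (top_homotopyE lt_ip) ?top_add ?(ltn_trans lt_ji) //.
  have le_p : (U_(p) <= mu)%MM by rewrite lep1mP -lt0n.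
  rewrite -(submK le_p); set nu := (mu - U_(p))%MM.
  by rewrite ![(nu + U_(p) + _)%MM]addmAC !addmK -cocycle_antisym cocycle_jacobi.
rewrite (@top_homotopyE j i) //; last first.
  apply/and3P; split=> //; first by rewrite mnmDE mnm1E eqxx addn1.
  apply/forallP=> l; apply/implyP=> lt_il; rewrite mnmDE mnm1E mu0 // eqb0.
  by apply/negP=> /eqP il; rewrite il ltnn in lt_il.
rewrite top_homotopy0 ?subr0 ?addmK; last first.
  move=> l lt_il; left; rewrite mnmDE mnm1E mu0 //.
  by case: eqP lt_il => // <-; rewrite ltnNge (ltnW lt_ji).
by rewrite (cocycle_antisym e i) addNr.
Qed.

(** The value at a multiple of the last variable z is forced by the wish that
    the shift by z give back [e].  With the value 0 at the other monomials,
    the cocycle identity for i, j, z would fail by the defect e i j mu; the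
    homotopy terms, carried by the pairs that contain z, compensate it. *)
Definition cocycle_div_val i j mu : V :=
  if (0 < mu ord_max)%N then e i j (mu - U_(ord_max))%MM
  else (if j == ord_max then top_homotopy i mu else 0)
       - (if i == ord_max then top_homotopy j mu else 0).

Lemma cocycle_div_alt i mu : cocycle_div_val i i mu = 0.
Proof. by rewrite /cocycle_div_val subrr; case: ifP; rewrite ?cocycle_alt. Qed.

Lemma cocycle_div_antisym i j mu :
  cocycle_div_val i j mu = - cocycle_div_val j i mu.
Proof.
by rewrite /cocycle_div_val; case: ifP; rewrite ?opprB // cocycle_antisym.
Qed.

Lemma cocycle_div_shift i j mu :
  cocycle_div_val i j (mu + U_(ord_max))%MM = e i j mu.
Proof. by rewrite /cocycle_div_val mnmDE mnm1E eqxx addn1 addmK. Qed.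

Lemma cocycle_div_jacobi i j k mu :
  cocycle_div_val i j (mu + U_(k))%MM + cocycle_div_val j k (mu + U_(i))%MM
    + cocycle_div_val k i (mu + U_(j))%MM = 0.
Proof.
have [mu_z|mu_z] := posnP (mu ord_max); last first.
  have le_z : (U_(ord_max) <= mu)%MM by rewrite lep1mP -lt0n.
  rewrite -(submK le_z) ![(_ + U_(ord_max) + _)%MM]addmAC !cocycle_div_shift.
  exact: cocycle_jacobi.
have lt_m l : l != ord_max -> (l < m)%N.
  by rewrite -val_eqE ltn_neqAle -ltnS ltn_ord andbT.
have shiftE a b c : cocycle_div_val a b (mu + U_(c))%MM =
    if c == ord_max then e a b mu
    else (if b == ord_max then top_homotopy a (mu + U_(c))%MM else 0)
         - (if a == ord_max then top_homotopy b (mu + U_(c))%MM else 0).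
  case: (eqVneq c ord_max) => [->|cz]; first exact: cocycle_div_shift.
  by rewrite /cocycle_div_val mnmDE mnm1E mu_z (negPf cz).
(* No index is the last one, exactly one is, or two of them coincide; only the
   second case needs more than the alternating property. *)
rewrite !shiftE.
have [iz|iz] := eqVneq i ord_max; have [jz|jz] := eqVneq j ord_max;
  have [kz|kz] := eqVneq k ord_max; rewrite ?subr0 ?sub0r ?subrr ?iz ?jz ?kz.
- by rewrite !cocycle_alt !addr0.
- by rewrite subrr add0r (cocycle_antisym e k) subrr.
- by rewrite subrr addr0 (cocycle_antisym e j) subrr.
- rewrite addrC addrA addrC addrA.
  exact: top_homotopyP (lt_m _ jz) (lt_m _ kz).
- by rewrite subrr addr0 (cocycle_antisym e i) addNr.
- by rewrite addrC addrA; exact: top_homotopyP (lt_m _ kz) (lt_m _ iz).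
- exact: top_homotopyP (lt_m _ iz) (lt_m _ jz).
- by rewrite !addr0.
Qed.

Definition cocycle_div : cocycle m.+1 V :=
  Cocycle cocycle_div_alt cocycle_div_antisym cocycle_div_jacobi.

(** The homotopy only brings in values e i l with l after i: hence the edges at
    the last vertex are harmless when e also vanishes on its neighbours and
    these form a final segment. *)
Lemma cocycle_div_eq0 i j mu :
  (forall nu, e i j nu = 0) ->
  (j = ord_max ->
    forall l : 'I_m.+1, (i < l < m)%N -> forall nu, e i l nu = 0) ->
  (i = ord_max ->
    forall l : 'I_m.+1, (j < l < m)%N -> forall nu, e j l nu = 0) ->
  cocycle_div i j mu = 0.
Proof.
move=> e0 ei0 ej0; rewrite /= /cocycle_div_val; case: ifP => // _.
have -> : (if j == ord_max then top_homotopy i mu else 0) = 0.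
  by case: eqP => // jz; apply: top_homotopy0 => l il; right; apply: ei0.
have -> : (if i == ord_max then top_homotopy j mu else 0) = 0.
  by case: eqP => // iz; apply: top_homotopy0 => l jl; right; apply: ej0.
exact: subrr.
Qed.

Lemma cocycle_div_const i : cocycle_div i ord_max 0%MM = 0.
Proof.
rewrite /= /cocycle_div_val mnm0E ltnn eqxx !top_homotopy0 ?if_same ?subrr //.
  by move=> l _; left; rewrite mnm0E.
by move=> l _; left; rewrite mnm0E.
Qed.

End Division.

(** * Division by x_n modulo the brackets of its neighbours *)

Section Centralizer.
Variables (R : comNzRingType) (m : nat) (G : rel 'I_m.+1).
Hypothesis HG : simple_graph G.
Local Notation M := (pcm R G).
Local Notation x := (pcm_gen R G).
Local Notation z := (@ord_max m).
Local Notation N := (neighbours G z).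
Implicit Types (i j k l : 'I_m.+1).

Definition neighbour_brackets (w : M) : Prop :=
  exists i j, [/\ i \in N, j \in N, (i < j)%N & w = [lie x i, x j]].

Local Notation S := neighbour_brackets.
Let pM := lie_proj_morphism S.
Let idS := ideal_gen_ideal S.

(** The tautological cocycle: [x_i, x_j].mu read modulo the ideal generated by
    the brackets of two neighbours of z. *)
Definition quotient_cocycle_val i j mu : lie_quot S :=
  lie_proj S (pcm_act_mon [lie x i, x j] mu).

Lemma quotient_cocycle_alt i mu : quotient_cocycle_val i i mu = 0.
Proof.
by rewrite /quotient_cocycle_val bracketxx pcm_act_mon0l (lie_morphism0 pM).
Qed.

Lemma quotient_cocycle_antisym i j mu :
  quotient_cocycle_val i j mu = - quotient_cocycle_val j i mu.
Proof.
rewrite /quotient_cocycle_val bracketC pcm_act_monNl -scaleN1r (lie_morphismZ pM).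
by rewrite scaleN1r.
Qed.

Lemma quotient_cocycle_jacobi i j k mu :
  quotient_cocycle_val i j (mu + U_(k))%MM
  + quotient_cocycle_val j k (mu + U_(i))%MM
  + quotient_cocycle_val k i (mu + U_(j))%MM = 0.
Proof.
rewrite /quotient_cocycle_val ![(mu + _)%MM]addmC.
rewrite !pcm_act_monD; try exact: derived_bracket.
rewrite -!(lie_morphismD pM) -!pcm_act_monDl !pcm_act_mon1 jacobi pcm_act_mon0l.
exact: lie_morphism0 pM.
Qed.

Definition quotient_cocycle : cocycle m.+1 (lie_quot S) :=
  Cocycle quotient_cocycle_alt quotient_cocycle_antisym quotient_cocycle_jacobi.

Lemma quotient_cocycle_edge i j mu : G i j -> quotient_cocycle i j mu = 0.
Proof.
move=> Gij; rewrite /= /quotient_cocycle_val pcm_edge // pcm_act_mon0l.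
exact: lie_morphism0 pM.
Qed.

Lemma quotient_cocycle_neighbours i j mu :
  i \in N -> j \in N -> (i < j)%N -> quotient_cocycle i j mu = 0.
Proof.
move=> Ni Nj lt_ij; apply/lie_proj_eq0; elim/mnm_ind: mu => [|mu k IHmu].
  by rewrite pcm_act_mon0; apply: ideal_gen_sub; exists i, j.
rewrite pcm_act_monD; last exact: derived_bracket.
by rewrite pcm_act_mon1; case: idS => _; apply.
Qed.

Hypothesis N_top : forall i l, i \in N -> (i < l < m)%N -> l \in N.

(** Multiplication by x_n on the derived subalgebra has a linear left inverse
    modulo the ideal generated by the brackets of the neighbours of x_n: it is
    the functional of the divided tautological cocycle. *)
Lemma pcm_division :
  exists phi : M -> lie_quot S,
    [/\ forall a u v, phi (a *: u + v) = a *: phi u + phi v,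
        forall k, phi [lie x k, x z] = 0 &
        forall w, derived w -> phi [lie w, x z] = lie_proj S w].
Proof.
have symG : ssrbool.symmetric G by case: HG.
have [i j mu Gij|phi [phiZD _ phiE]] :=
    @pcm_cocycle_functional R _ G _ (cocycle_div quotient_cocycle).
  have NG l : l \in N -> forall k, (l < k < m)%N -> forall nu,
      quotient_cocycle l k nu = 0.
    move=> Nl k lk nu; apply: quotient_cocycle_neighbours => //.
      exact: N_top lk.
    by case/andP: lk.
  apply: cocycle_div_eq0 => [nu|jz|iz].
  - exact: quotient_cocycle_edge.
  - by apply: NG; rewrite inE -jz symG.
  - by apply: NG; rewrite inE -iz.
exists phi; split=> // [k|w].
  by rewrite -[[lie _, _]]pcm_act_mon0 phiE cocycle_div_const.
move/derived_monomial_span=> Sw.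
apply: (Sw (fun w => phi [lie w, x z] = lie_proj S w)).
  split=> [|a u v phiu phiv].
    rewrite bracket0l (lie_morphism0 pM).
    exact: linear_map0.
  by rewrite bracketPl phiZD phiu phiv (lie_morphismZD pM).
move=> i j mu; rewrite -pcm_act_mon1 -pcm_act_monD; last exact: derived_bracket.
by rewrite phiE; apply: cocycle_div_shift.
Qed.

(** * Combinations of brackets of neighbours *)

Definition neighbour_form (f : 'I_m.+1 -> 'I_m.+1 -> {mpoly R[m]}) : M :=
  \sum_i \sum_(j | [&& i \in N, j \in N & (i < j)%N])
    pcm_act [lie x i, x j] (mwiden (f i j)).

Lemma neighbour_form_linear a f g :
  neighbour_form (fun i j => a *: f i j + g i j)
  = a *: neighbour_form f + neighbour_form g.
Proof.
rewrite /neighbour_form scaler_sumr -big_split; apply: eq_bigr => i _ /=.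
rewrite scaler_sumr -big_split; apply: eq_bigr => j _ /=.
by rewrite mwidenD mwidenZ pcm_act_linear_r.
Qed.

Lemma neighbour_form0 : neighbour_form (fun _ _ => 0) = 0.
Proof.
by rewrite /neighbour_form big1 // => i _; rewrite big1 // => j _;
  rewrite mwiden0 pcm_act0r.
Qed.

Lemma neighbour_form_derived f : derived (neighbour_form f).
Proof.
apply: (submodule_sum (@derived_submodule _ _)) => i _.
apply: (submodule_sum (@derived_submodule _ _)) => j _.
by apply: pcm_act_derived; apply: derived_bracket.
Qed.

(** By the Jacobi identity, as x_i and x_j commute with x_n. *)
Lemma neighbour_form_centralizes f : [lie neighbour_form f, x z] = 0.
Proof.
rewrite bracket_suml big1 // => i _; rewrite bracket_suml big1 // => j.
case/and3P; rewrite !inE => zi zj _.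
have symG : ssrbool.symmetric G by case: HG.
rewrite -pcm_actX -pcm_actM; last exact: derived_bracket.
rewrite mulrC pcm_actM; last exact: derived_bracket.
have := jacobi (x i) (x j) (x z).
rewrite [[lie x j, x z]]pcm_edge; last by rewrite symG.
by rewrite (pcm_edge _ zi) !bracket0l !addr0 pcm_actX => ->; rewrite pcm_act0l.
Qed.

(** Since x_n kills the combinations of brackets of neighbours, the polynomials never have to involve the
    last variable. *)
Lemma neighbour_form_gen f k :
  exists g, [lie neighbour_form f, x k] = neighbour_form g.
Proof.
have [->|kz] := eqVneq k z.
  by exists (fun _ _ => 0); rewrite neighbour_form_centralizes neighbour_form0.
have lt_km : (k < m)%N by rewrite ltn_neqAle -ltnS ltn_ord andbT.
exists (fun i j => f i j * 'X_(Ordinal lt_km)).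
rewrite bracket_suml; apply: eq_bigr => i _.
rewrite bracket_suml; apply: eq_bigr => j _.
rewrite mwidenM mwidenX mnmwiden1 pcm_actM; last exact: derived_bracket.
by rewrite pcm_actX; congr [lie _, x _]; apply: val_inj.
Qed.

(** The combinations of brackets of neighbours form an ideal: their bracket with
    any v only sees the linear part of v, as the derived subalgebra is abelian. *)
Lemma neighbour_idealP u :
  ideal_gen S u -> exists f, u = neighbour_form f.
Proof.
pose P u := exists f, u = neighbour_form f.
have subP : is_submodule P.
  split=> [|a _ _ [f ->] [g ->]]; last by eexists; rewrite -neighbour_form_linear.
  by exists (fun _ _ => 0); rewrite neighbour_form0.
move=> Su; apply: (Su P) => [|_ [a [b [Na Nb lt_ab ->]]]].
  split=> // _ v [f ->]; have [b [w [Sw ->]]] := pcm_decomposition v.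
  rewrite bracketDr (pcm_derived_bracket0 (neighbour_form_derived f)
    (monomial_span_derived Sw)).
  rewrite addr0 bracket_sumr; apply: (submodule_sum subP) => k _.
  by rewrite bracketZr; apply: (submoduleZ subP); apply: neighbour_form_gen.
exists (fun i j => ((i == a) && (j == b))%:R).
rewrite /neighbour_form (bigD1 a) //= (bigD1 b) /= ?Na ?Nb //.
rewrite !eqxx mwiden1 pcm_act1.
rewrite !big1 ?addr0 // => [i /negPf ia|j /andP[_ /negPf jb]].
  by rewrite big1 // => j _; rewrite ia mwiden0 pcm_act0r.
by rewrite jb mwiden0 pcm_act0r.
Qed.

End Centralizer.

(** * Detecting a nonedge *)

Section NonEdge.
Variables (R : comNzRingType) (n : nat) (k l : 'I_n).

(** Concentrated at the monomial 1, so that the cocycle identity, which involves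
    only monomials of positive degree, is void: the degree two part of M(X;G) is
    free on the nonedges, and this is a coordinate on it. *)
Definition nonedge_val (i j : 'I_n) (mu : 'X_{1..n}) : R^o :=
  if mu == 0%MM then ((i == k) && (j == l))%:R - ((i == l) && (j == k))%:R
  else 0.

Let add_neq0 (mu : 'X_{1..n}) i : ((mu + U_(i))%MM == 0%MM) = false.
Proof. by rewrite -mdeg_eq0 mdegD mdeg1 addn1. Qed.

Lemma nonedge_alt i mu : nonedge_val i i mu = 0.
Proof. by rewrite /nonedge_val andbC subrr; case: ifP. Qed.

Lemma nonedge_antisym i j mu : nonedge_val i j mu = - nonedge_val j i mu.
Proof.
rewrite /nonedge_val; case: ifP; rewrite ?oppr0 // opprB.
by rewrite (andbC (i == k)) (andbC (i == l)).
Qed.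

Lemma nonedge_jacobi i j p mu :
  nonedge_val i j (mu + U_(p))%MM + nonedge_val j p (mu + U_(i))%MM
    + nonedge_val p i (mu + U_(j))%MM = 0.
Proof. by rewrite /nonedge_val !add_neq0 !addr0. Qed.

Definition nonedge_cocycle : cocycle n R^o :=
  Cocycle nonedge_alt nonedge_antisym nonedge_jacobi.

Lemma pcm_nonedge_functional (G : rel 'I_n) :
  simple_graph G -> k != l -> ~~ G k l ->
  exists phi : pcm R G -> R^o,
    [/\ forall a u v, phi (a *: u + v) = a *: phi u + phi v,
        phi [lie pcm_gen R G k, pcm_gen R G l] = 1 &
        forall i, i != k -> phi [lie pcm_gen R G i, pcm_gen R G l] = 0].
Proof.
move=> [symG _] kl Gkl.
have [i j mu Gij|phi [phiZD _ phiE]] :=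
    @pcm_cocycle_functional R _ G _ nonedge_cocycle.
  rewrite /= /nonedge_val; case: eqP => // _.
  case: andP Gij => [[/eqP-> /eqP->] Gij|_ Gij]; first by rewrite Gij in Gkl.
  case: andP Gij => [[/eqP-> /eqP->] Gij|_ Gij]; last by rewrite subrr.
  by rewrite symG Gij in Gkl.
exists phi; split=> // [|i ik]; rewrite -[[lie _, _]]pcm_act_mon0 phiE /=.
  by rewrite /nonedge_val !eqxx (negPf kl) subr0.
by rewrite /nonedge_val eqxx (negPf ik) (eq_sym l) (negPf kl) andbF subrr.
Qed.

End NonEdge.

(** * The centralizer of the last vertex *)

Section Main.
Variables (R : comNzRingType) (m : nat) (G : rel 'I_m.+1).
Hypothesis HG : simple_graph G.
Local Notation M := (pcm R G).
Local Notation x := (pcm_gen R G).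
Local Notation z := (@ord_max m).
Local Notation N := (neighbours G z).
Hypothesis N_top :
  forall i l : 'I_m.+1, i \in N -> (i < l < m)%N -> l \in N.

(** For v = sum a_k x_k + w, the division functional takes the value w (modulo
    the ideal) on [v, x_n], as it kills all the [x_k, x_n].  Hence w is a
    combination of brackets of neighbours, commutes with x_n, and the sum of the
    a_k [x_k, x_n] is zero; the nonedge functionals then kill the a_k. *)
Lemma centralizerE (v : M) :
  centralizer (x z) v <->
  exists (a : 'I_m.+1 -> R) f,
    v = \sum_(k | (k \in N) || (k == z)) a k *: x k + neighbour_form G f.
Proof.
have symG : ssrbool.symmetric G by case: HG.
split=> [|[a [f ->]]]; last first.
  rewrite /centralizer bracketDl neighbour_form_centralizes // addr0.
  rewrite bracket_suml big1 // => k; rewrite inE bracketZl.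
  case/orP=> [zk|/eqP->]; last by rewrite bracketxx scaler0.
  by rewrite pcm_edge ?scaler0 // symG.
have [a [w [Sw ->]]] := pcm_decomposition v; rewrite /centralizer => vz0.
have Dw := monomial_span_derived Sw.
have lin_sum (W : lmodType R) (phi : M -> W) :
    (forall a u v, phi (a *: u + v) = a *: phi u + phi v) ->
    forall w, phi [lie \sum_k a k *: x k + w, x z]
    = \sum_k a k *: phi [lie x k, x z] + phi [lie w, x z].
  move=> phiZD w'; rewrite bracketDl bracket_suml.
  elim: (index_enum _) => [|k s IHs]; first by rewrite !big_nil !add0r.
  by rewrite !big_cons -!addrA bracketZl phiZD IHs.
have [phi [phiZD phi0 phiw]] := pcm_division R HG N_top.
have phi00 := linear_map0 phiZD.
have [f Ew] : exists f, w = neighbour_form G f.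
  apply: neighbour_idealP => //; apply/lie_proj_eq0.
  rewrite -phiw // -phi00 -vz0 lin_sum // big1 ?add0r // => k _.
  by rewrite phi0 scaler0.
exists a, f; rewrite -Ew; congr (_ + _).
rewrite [LHS](bigID (fun k => (k \in N) || (k == z))) /= -[RHS]addr0.
congr (_ + _); rewrite big1 // => k; rewrite inE negb_or => /andP[zk kz].
have [|psi [psiZD psi1 psi0]] := pcm_nonedge_functional R HG kz.
  by rewrite symG.
have psi00 := linear_map0 psiZD.
have := lin_sum _ _ psiZD w; rewrite vz0 Ew neighbour_form_centralizes // psi00.
rewrite addr0 (bigD1 k) //= psi1 big1 => [|i ik]; last by rewrite psi0 ?scaler0.
by rewrite addr0 [_ *: _]mulr1 => <-; rewrite scale0r.
Qed.

End Main.

(* There are n = m + 1 vertices, indexed from 0: the paper's x_k is the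
   vertex of index k - 1 of 'I_m.+1, so x_n is ord_max.  Polynomials in
   X \ {x_n} are elements of {mpoly R[m]}, embedded in R[X] by mwiden. *)
Theorem theorem4p9 (R : comNzRingType) (m : nat) (G : rel 'I_m.+1)
    (HG : simple_graph G) :
  let x : 'I_m.+1 -> pcm R G := pcm_gen R G in
  [/\ (* 1 *)
      isolated G ord_max ->
      forall v : pcm R G,
        centralizer (x ord_max) v <->
        exists a : R, v = a *: x ord_max,
      (* 2 *)
      forall y : 'I_m.+1, (y.+1 = m)%N ->
      degree G ord_max = 1%N -> G ord_max y ->
      forall v : pcm R G,
        centralizer (x ord_max) v <->
        exists a b : R, v = a *: x y + b *: x ord_max
    & (* 3 *)
      forall r : nat, (r + 3 <= m.+1)%N ->
      neighbours G ord_max = [set k : 'I_m.+1 | (r <= k < m)%N] ->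
      forall v : pcm R G,
        centralizer (x ord_max) v <->
        exists (a : 'I_m.+1 -> R) (f : 'I_m.+1 -> 'I_m.+1 -> {mpoly R[m]}),
          v = \sum_(k < m.+1 | (r <= k)%N) a k *: x k
              + \sum_(i < m.+1) \sum_(j < m.+1 | (r <= i < j)%N && (j < m)%N)
                  pcm_act [lie x i, x j] (mwiden (f i j)) ].
Proof.
move=> x; split=> [iso v|y ym deg1 Gzy v|r rm Nr v].
- rewrite centralizerE // => [|i l]; last by rewrite iso inE.
  have form0 f : neighbour_form G f = 0.
    by rewrite /neighbour_form big1 // => i _; rewrite big_pred0 // => j;
      rewrite iso inE.
  have sumE (a : 'I_m.+1 -> R) :
      \sum_(k | (k \in neighbours G ord_max) || (k == ord_max)) a k *: x k
      = a ord_max *: x ord_max.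
    by apply: big_pred1 => k; rewrite iso inE.
  split=> [[a [f ->]]|[a ->]].
    by exists (a ord_max); rewrite form0 addr0 sumE.
  by exists (fun=> a), (fun _ _ => 0); rewrite form0 addr0 sumE.
- have Ny : neighbours G ord_max = [set y].
    apply/eqP; rewrite eq_sym eqEcard sub1set inE Gzy cards1.
    by rewrite -/(degree _ _) deg1.
  have yz : y != ord_max.
    by apply/eqP=> yz; move: ym; rewrite yz => /eqP; rewrite gtn_eqF.
  rewrite centralizerE // => [|i l]; last first.
    by rewrite Ny inE => /eqP -> /andP[yl lm]; rewrite ym leqNgt lm in yl.
  have form0 f : neighbour_form G f = 0.
    rewrite /neighbour_form big1 // => i _; rewrite big_pred0 // => j.
    by rewrite Ny !inE; apply/and3P=> -[/eqP-> /eqP->]; rewrite ltnn.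
  have sumE (a : 'I_m.+1 -> R) :
      \sum_(k | (k \in neighbours G ord_max) || (k == ord_max)) a k *: x k
      = a y *: x y + a ord_max *: x ord_max.
    rewrite (bigD1 y) ?Ny ?inE ?eqxx //=; congr (_ + _).
    apply: big_pred1 => k; rewrite /= inE.
    by case: (eqVneq k y) => [->|_] /=; rewrite ?andbT ?(negPf yz).
  split=> [[a [f ->]]|[a [b ->]]].
    by exists (a y), (a ord_max); rewrite form0 addr0 sumE.
  exists (fun k => if k == y then a else b), (fun _ _ => 0).
  by rewrite form0 addr0 sumE eqxx eq_sym (negPf yz).
have NrE k : (k \in neighbours G ord_max) = (r <= k < m)%N by rewrite Nr inE.
rewrite centralizerE // => [|i l]; last first.
  by rewrite !NrE => /andP[ri _] /andP[il ->]; rewrite (leq_trans ri (ltnW il)).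
have le_rm : (r <= m)%N.
  by rewrite -ltnS; apply: leq_trans rm; rewrite -addn1 leq_add2l.
have sumE (a : 'I_m.+1 -> R) :
    \sum_(k | (k \in neighbours G ord_max) || (k == ord_max)) a k *: x k
    = \sum_(k < m.+1 | (r <= k)%N) a k *: x k.
  apply: eq_bigl => k; rewrite NrE -val_eqE /=.
  have := ltn_ord k; rewrite ltnS leq_eqVlt => /predU1P[->|lt_km].
    by rewrite eqxx orbT le_rm.
  by rewrite lt_km andbT ltn_eqF ?orbF.
have formE f : neighbour_form G f =
    \sum_(i < m.+1) \sum_(j < m.+1 | (r <= i < j)%N && (j < m)%N)
      pcm_act [lie x i, x j] (mwiden (f i j)).
  apply: eq_bigr => i _; apply: eq_bigl => j; rewrite !NrE.
  apply/and3P/andP=> [[/andP[-> _] /andP[_ ->] ->] //|[/andP[ri ij] jm]].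
  by rewrite ri (ltn_trans ij jm) (leq_trans ri (ltnW ij)).
by split=> -[a [f ->]]; exists a, f; rewrite formE sumE.
Qed.
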